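(* Let $q$ be a prime power and $d<n$. Let $\mathrm{C}_1,\mathrm{C}_2\subseteq\mathrm{H}_n(q^2)$ be maximum additive Hermitian $d$-codes which are both $(n-d)$-designs. Then $\mathrm{C}_1$ and $\mathrm{C}_2$ are equivalent in $\mathrm{H}_n(q^2)$ if and only if they are extended equivalent.
   Context: For $a\in\mathbb{F}_{q^2}$ write $\bar a=a^q$; $A^*$ is the conjugate transpose, $A^T$ the transpose, and $C^\rho$ the matrix obtained by applying a field automorphism $\rho$ to every entry of $C$; $\mathrm{H}_n(q^2)=\{A\in\mathbb{F}_{q^2}^{n\times n}:A^*=A\}$. A $d$-code is a subset $\mathrm{C}$ with $\mathrm{rk}(A-B)\ge d$ for distinct $A,B\in\mathrm{C}$; additive means a subgroup under addition; a maximum additive Hermitian $d$-code is an additive $d$-code in $\mathrm{H}_n(q^2)$ of size $q^{n(n-d+1)}$. Two subsets $\mathrm{C}_1,\mathrm{C}_2\subseteq\mathrm{H}_n(q^2)$ are equivalent in $\mathrm{H}_n(q^2)$ if $\mathrm{C}_2=\{aAC^\rho A^*+B: C\in\mathrm{C}_1\}$ for some $a\in\mathbb{F}_q^*$, $\rho\in\mathrm{Aut}(\mathbb{F}_{q^2})$, $A\in\mathrm{GL}(n,q^2)$, $B\in\mathrm{H}_n(q^2)$. They are extended equivalent if $\mathrm{C}_2=\{\Psi(C):C\in\mathrm{C}_1\}$ where $\Psi(C)=AC^\sigma B+R$ or $\Psi(C)=A(C^\sigma)^TB+R$ for some $A,B\in\mathrm{GL}(n,q^2)$, $\sigma\in\mathrm{Aut}(\mathbb{F}_{q^2})$,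 $R\in\mathbb{F}_{q^2}^{n\times n}$. Designs: fix a nontrivial character $\chi$ of $(\mathbb{F}_q,+)$, $\langle A,B\rangle=\chi(\mathrm{tr}(A^*B))$; $\mathrm{H}_k$ is the set of rank-$k$ matrices in $\mathrm{H}_n(q^2)$; $Q_k(i)=\sum_{A\in\mathrm{H}_k}\langle A,B\rangle$ for $B\in\mathrm{H}_i$; inner distribution $A_i=|\{(X,Y)\in\mathrm{C}^2:\mathrm{rk}(X-Y)=i\}|/|\mathrm{C}|$; dual inner distribution $A'_k=\sum_iQ_k(i)A_i$; $\mathrm{C}$ is a $t$-design if $A'_1=\dots=A'_t=0$. *)

(* Defs.v *)
From HB Require Import structures.
From mathcomp Require Import all_boot all_order all_algebra all_field.
Set Implicit Arguments. Unset Strict Implicit. Unset Printing Implicit Defensive.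
Import GRing.Theory Num.Theory.
Local Open Scope ring_scope.

Section Herm.
Variables (F : finFieldType) (q n : nat).

(* conjugation  a |-> a^q  on F = F_{q^2} *)
Definition conjq (a : F) : F := a ^+ q.
Definition inFq (a : F) : bool := a ^+ q == a.
Definition ctmx (A : 'M[F]_n) : 'M[F]_n := (map_mx conjq A)^T.
Definition hermitian (A : 'M[F]_n) : bool := ctmx A == A.

Definition is_dcode (d : nat) (C : {set 'M[F]_n}) : Prop :=
  forall A B, A \in C -> B \in C -> A != B -> (d <= \rank (A - B)%R)%N.

Definition additive_set (C : {set 'M[F]_n}) : Prop :=
  0 \in C /\ forall A B, A \in C -> B \in C -> A - B \in C.

Definition max_add_herm_code (d : nat) (C : {set 'M[F]_n}) : Prop :=
  [/\ (forall A, A \in C -> hermitian A), additive_set C, is_dcode d C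
    & #|C| = (q ^ (n * (n - d + 1)))%N].

(* chi : a nontrivial character of (F_q, +), given as a function on F whose
   restriction to F_q is the character *)
Definition nontriv_add_char (chi : F -> algC) : Prop :=
  [/\ (forall a, inFq a -> chi a != 0),
      (forall a b, inFq a -> inFq b -> chi (a + b) = chi a * chi b)
    & exists a, inFq a /\ chi a != 1].

Definition pairing (chi : F -> algC) (A B : 'M[F]_n) : algC := chi (\tr (ctmx A *m B)).

Definition QkB (chi : F -> algC) (k : nat) (B : 'M[F]_n) : algC :=
  \sum_(A : 'M[F]_n | hermitian A && (\rank A == k)) pairing chi A B.

Definition Qk (chi : F -> algC) (k i : nat) : algC :=
  if [pick B : 'M[F]_n | hermitian B && (\rank B == i)] is Some B
  then QkB chi k B else 0.

Definition inner_dist (C : {set 'M[F]_n}) (i : nat) : algC :=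
  #|[set XY : 'M[F]_n * 'M[F]_n |
      [&& XY.1 \in C, XY.2 \in C & \rank (XY.1 - XY.2) == i]]|%:R / #|C|%:R.

Definition dual_inner_dist (chi : F -> algC) (C : {set 'M[F]_n}) (k : nat) : algC :=
  \sum_(i < n.+1) Qk chi k i * inner_dist C i.

Definition is_design (chi : F -> algC) (t : nat) (C : {set 'M[F]_n}) : Prop :=
  forall k, (1 <= k <= t)%N -> dual_inner_dist chi C k = 0.

Definition equiv_herm (C1 C2 : {set 'M[F]_n}) : Prop :=
  exists (a : F) (rho : {rmorphism F -> F}) (A B : 'M[F]_n),
    [/\ inFq a && (a != 0), bijective rho, A \in unitmx, hermitian B
      & C2 = [set a *: (A *m map_mx rho C *m ctmx A) + B | C in C1]].

Definition ext_equiv (C1 C2 : {set 'M[F]_n}) : Prop :=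
  exists (A B : 'M[F]_n) (sigma : {rmorphism F -> F}) (R : 'M[F]_n),
    [/\ A \in unitmx, B \in unitmx, bijective sigma &
      (C2 = [set A *m map_mx sigma C *m B + R | C in C1] \/
       C2 = [set A *m (map_mx sigma C)^T *m B + R | C in C1])].

End Herm.

(* Main.v *)
Require Import Defs.
From HB Require Import structures.
From mathcomp Require Import all_boot all_order all_algebra all_field.
Import GRing.Theory Num.Theory.
Local Open Scope ring_scope.

(** If [A C^sigma B + R] stays Hermitian as [C] runs over [C1], then pulling back
    [(B^* )^-1 A] along [sigma] gives a matrix [X] with [X C = C X^*] for all [C]
    in [C1]; everything reduces to showing that [X] is a scalar of F_q.  Suppose
    [v] and [v X] are independent.  Then [v X C v^*] lies in F_q for all [C].  If
    n - d >= 2, this says that a rank-2 Hermitian matrix is orthogonal to [C1],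
    against the design property.  If n - d = 1, then [v C = 0] forces
    [v X C = 0], so [C |-> v C] is injective on the q^(2n) codewords, yet its
    image misses part of F_{q^2}^n.  Hence every vector is an eigenvector of [X].
    The transposed case is the same with [sigma] composed with conjugation, as
    [C^T] is the conjugate of [C]. *)

Set Implicit Arguments.
Unset Strict Implicit.
Unset Printing Implicit Defensive.

(* MathComp's forms library shadows this name. *)
Local Notation hermitian := Defs.hermitian.

(** * Conjugation on F_{q^2}: fixed points, trace and norm *)

Lemma conjq_rmorphism (F : finFieldType) (p k q : nat) :
  prime p -> q = (p ^ k)%N -> #|{: F}| = (q ^ 2)%N ->
  {tau : {rmorphism F -> F} | tau =1 conjq q}.
Proof.
move=> pr_p Eq cardF.
have chF : p \in [pchar F].
  by apply: (@card_finPcharP _ _ (k * 2)) => //; rewrite cardF Eq expnM.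
have qnat : [pchar F].-nat q.
  rewrite Eq pnatX; apply/orP; left.
  by rewrite (eq_pnat _ (pcharf_eq chF)) pnat_id.
have fB : zmod_morphism (@conjq F q).
  by move=> x y; rewrite /conjq exprDn_pchar // exprNn_pchar.
have fM : monoid_morphism (@conjq F q).
  by split=> [|x y]; rewrite /conjq ?expr1n ?exprMn.
pose t1 := GRing.isZmodMorphism.Build F F (@conjq F q) fB.
pose t2 := GRing.isMonoidMorphism.Build F F (@conjq F q) fM.
pose tau : {rmorphism F -> F} := HB.pack (@conjq F q) t1 t2.
by exists tau.
Qed.

Section QuadraticConjugation.

Variables (F : finFieldType) (q : nat) (tau : {rmorphism F -> F}).
Hypothesis q_gt1 : (1 < q)%N.
Hypothesis cardF : #|{: F}| = (q ^ 2)%N.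
Hypothesis tauE : tau =1 conjq q.

Lemma tauK : involutive tau.
Proof.
by move=> x; rewrite !tauE /conjq -exprM -[RHS](expf_card x) cardF -mulnn.
Qed.

Lemma card_roots_lt (p : {poly F}) : p != 0 -> (#|[pred x | root p x]| < size p)%N.
Proof.
move=> p0; rewrite cardE; apply: max_poly_roots => //; last exact: enum_uniq.
by apply/allP=> x; rewrite mem_enum.
Qed.

Lemma card_fixed_le : (#|[pred x | tau x == x]| <= q)%N.
Proof.
have szp : size ('X^q - 'X : {poly F}) = q.+1.
  by rewrite size_polyDl size_polyXn // size_polyN size_polyX ltnS.
have p0 : ('X^q - 'X : {poly F}) != 0 by rewrite -size_poly_eq0 szp.
have := card_roots_lt p0; rewrite szp ltnS; apply: leq_trans.
apply/subset_leq_card/subsetP=> x; rewrite !inE => /eqP fx.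
by rewrite /root !hornerE -/(conjq q x) -tauE fx subrr.
Qed.

Lemma exists_not_fixed : exists x, tau x != x.
Proof.
apply/existsP; rewrite -negb_forall; apply/negP=> /forallP fx.
have := card_fixed_le; rewrite (eq_card (B := F)); last first.
  by move=> x; rewrite !inE fx.
by rewrite cardF leqNgt -{1}(expn1 q) ltn_exp2l.
Qed.

(** Outside characteristic 2 the element 1 works; in characteristic 2 the trace of [y] equals
    [y - tau y], nonzero when [y] is not fixed. *)
Lemma exists_trace_neq0 : exists x, x + tau x != 0.
Proof.
have [y yN] := exists_not_fixed.
have [t0|] := eqVneq (1 + tau 1) 0; last by exists 1.
exists y; apply: contraNneq yN => ty.
have N1 : -1 = 1 :> F.
  by apply/esym/eqP; rewrite -addr_eq0 -{2}(rmorph1 tau) t0.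
by rewrite -[tau y]mul1r -{1}N1 mulN1r eq_sym -addr_eq0 ty.
Qed.

Lemma exists_antifixed : exists2 x, x != 0 & tau x = - x.
Proof.
have [y yN] := exists_not_fixed.
by exists (y - tau y); rewrite ?rmorphB /= ?tauK ?opprB // subr_eq0 eq_sym.
Qed.

(** Counting: if c were missed, the q^2 - 1 nonzero elements would have norms among at most q - 2
    values, each with at most q + 1 preimages, as roots of X^(q+1) - y. But (q - 2)(q + 1) < q^2 -
    1. *)
Lemma norm_surj c : c != 0 -> tau c = c -> exists x, x * tau x = c.
Proof.
move=> c0 fc; apply/exists_eqP; case: (boolP [exists x, _]) => // /existsPn nc.
pose nrm (x : F) := x * tau x.
have fiber y : (#|[pred x | nrm x == y]| <= q.+1)%N.
  have szp : size ('X^(q.+1) - y%:P : {poly F}) = q.+2 by rewrite size_XnsubC.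
  have p0 : ('X^(q.+1) - y%:P : {poly F}) != 0 by rewrite -size_poly_eq0 szp.
  have := card_roots_lt p0; rewrite szp ltnS; apply: leq_trans.
  apply/subset_leq_card/subsetP=> x; rewrite !inE /nrm tauE /conjq -exprS => /eqP<-.
  by rewrite /root !hornerE subrr.
pose U := [pred x | tau x == x & (x != 0) && (x != c)].
have cardU : (#|U| <= q - 2)%N.
  apply: leq_trans (leq_sub2r 2 card_fixed_le).
  rewrite (cardD1 0 [pred x | tau x == x]) inE rmorph0 eqxx.
  rewrite (cardD1 c [predD1 _ & _]) !inE c0 fc eqxx addnA !subSS subn0.
  apply: subset_leq_card.
  by apply/subsetP=> x; rewrite !inE => /and3P[-> -> ->].
have : (#|[pred x : F | x != 0%R]| <= #|U| * q.+1)%N.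
  rewrite -sum1_card (partition_big nrm U) /=; last first.
    move=> x x0; apply/and3P; split; last exact: nc.
      by rewrite /nrm rmorphM /= tauK mulrC.
    by rewrite mulf_neq0 ?fmorph_eq0.
  rewrite -sum_nat_const; apply: leq_sum => y _.
  apply: leq_trans (fiber y); rewrite sum1_card; apply: subset_leq_card.
  by apply/subsetP=> x; rewrite !inE => /andP[].
have -> : #|[pred x : F | x != 0]| = (q ^ 2).-1.
  by rewrite -cardF -(cardC1 (0 : F)); apply: eq_card => x; rewrite !inE.
have le2 := leq_mul cardU (leqnn q.+1).
move=> /leq_trans/(_ le2).
case: (q) q_gt1 => [|[|r]] // _; rewrite subSS subSS subn0 -mulnn.
by rewrite 2!mulSn (mulnS r r.+2) !addSn /= ltn_add2l ltnNge -2!addSn leq_addl.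
Qed.

End QuadraticConjugation.

(** * Hermitian matrices up to congruence *)

Section ConjugateTranspose.

Variables (F : fieldType) (tau : {rmorphism F -> F}).

Definition adjmx m n (A : 'M[F]_(m, n)) : 'M[F]_(n, m) := (map_mx tau A)^T.

Lemma adjmxM m n p (A : 'M_(m, n)) (B : 'M_(n, p)) :
  adjmx (A *m B) = adjmx B *m adjmx A.
Proof. by rewrite /adjmx map_mxM trmx_mul. Qed.

Lemma adjmxD m n (A B : 'M_(m, n)) : adjmx (A + B) = adjmx A + adjmx B.
Proof. by rewrite /adjmx map_mxD linearD. Qed.

Lemma adjmxZ m n a (A : 'M_(m, n)) : adjmx (a *: A) = tau a *: adjmx A.
Proof. by rewrite /adjmx map_mxZ linearZ. Qed.

Lemma adjmx_col m1 m2 n (A : 'M_(m1, n)) (B : 'M_(m2, n)) :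
  adjmx (col_mx A B) = row_mx (adjmx A) (adjmx B).
Proof. by rewrite /adjmx map_col_mx tr_col_mx. Qed.

Lemma adjmx_inv n (A : 'M_n) : adjmx (invmx A) = invmx (adjmx A).
Proof. by rewrite /adjmx map_invmx trmx_inv. Qed.

Lemma adjmx_unit n (A : 'M_n) : (adjmx A \in unitmx) = (A \in unitmx).
Proof. by rewrite unitmx_tr map_unitmx. Qed.

Lemma trace_adjmx n (A : 'M_n) : \tr (adjmx A) = tau (\tr A).
Proof. by rewrite mxtrace_tr trace_map_mx. Qed.

Lemma adjmx_map (sigma : {rmorphism F -> F}) m n (A : 'M_(m, n)) :
  (forall x, sigma (tau x) = tau (sigma x)) ->
  adjmx (map_mx sigma A) = map_mx sigma (adjmx A).
Proof. by move=> st; apply/matrixP=> i j; rewrite !mxE st. Qed.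

Hypothesis tauK : involutive tau.

Lemma adjmxK m n (A : 'M_(m, n)) : adjmx (adjmx A) = A.
Proof. by apply/matrixP=> i j; rewrite !mxE tauK. Qed.

Lemma form_adjmx n (B : 'M_n) (v w : 'rV_n) :
  adjmx B = B -> (w *m B *m adjmx v) 0 0 = tau ((v *m B *m adjmx w) 0 0).
Proof.
move=> hB; have -> : w *m B *m adjmx v = adjmx (v *m B *m adjmx w).
  by rewrite !adjmxM adjmxK hB mulmxA.
by rewrite !mxE.
Qed.

(* Polarization: an identically vanishing quadratic form makes
   Tr(a * (v B w^* )) vanish for every scalar a. *)
Lemma herm_anisotropic n (B : 'M_n) :
  (exists x, x + tau x != 0) -> adjmx B = B -> B != 0 ->
  exists v : 'rV_n, (v *m B *m adjmx v) 0 0 != 0.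
Proof.
move=> [x trx] hB B0; pose h (v w : 'rV[F]_n) := (v *m B *m adjmx w) 0 0.
have hDl u v w : h (u + v) w = h u w + h v w by rewrite /h !mulmxDl mxE.
have hDr u v w : h u (v + w) = h u v + h u w by rewrite /h adjmxD mulmxDr mxE.
have hZl a v w : h (a *: v) w = a * h v w by rewrite /h -!scalemxAl mxE.
case: (pickP (fun ij : 'I_n * 'I_n => B ij.1 ij.2 != 0)) => [[i j] /= Bij|z]; last first.
  by case/eqP: B0; apply/matrixP=> i j; rewrite mxE; have /eqP := z (i, j).
have hij : h (delta_mx 0 i) (delta_mx 0 j) = B i j.
  rewrite /h -rowE; have -> : adjmx (delta_mx 0 j : 'rV[F]_n) = delta_mx j 0.
    by apply/matrixP=> a b; rewrite !mxE rmorph_nat andbC.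
  by rewrite -colE !mxE.
(* Scaled so that [h v w = x]; if [v] and [w] are both isotropic, [v + w] has value [x + tau x]. *)
pose v := (x / B i j) *: (delta_mx 0 i : 'rV[F]_n); pose w := delta_mx 0 j : 'rV[F]_n.
have hvw : h v w = x by rewrite hZl hij divfK.
have [v0|] := eqVneq (h v v) 0; last by exists v.
have [w0|] := eqVneq (h w w) 0; last by exists w.
exists (v + w); rewrite -/(h _ _) hDl !hDr v0 w0 add0r addr0 hvw.
by rewrite /h form_adjmx // -/(h v w) hvw.
Qed.

(** Gram-Schmidt: a vector v with v B v^* = 1 splits off the rank-one form w^* w, where w = v B. The
    remainder has smaller rank, since its left kernel contains that of B and gains v. *)
Lemma herm_gram n r (B : 'M_n) :
  (exists x, x + tau x != 0) ->
  (forall c, c != 0 -> tau c = c -> exists x, x * tau x = c) ->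
  adjmx B = B -> (\rank B <= r)%N -> exists M : 'M_(r, n), B = adjmx M *m M.
Proof.
move=> trN0 nsurj; elim: r B => [|r IH] B hB rB.
  exists 0; rewrite mulmx0; apply/eqP.
  by rewrite -mxrank_eq0 -leqn0.
have [->|B0] := eqVneq B 0; first by exists 0; rewrite mulmx0.
have [u hu] := herm_anisotropic trN0 hB B0.
set c := _ 0 0 in hu.
have tc : tau c = c by rewrite /c -form_adjmx.
have [a aN] : exists a, a * tau a = c^-1 by apply: nsurj; rewrite ?invr_eq0 ?fmorphV ?tc.
pose v := a *: u.
have hv : v *m B *m adjmx v = 1%:M.
  rewrite /v adjmxZ -!scalemxAl -scalemxAr scalerA aN.
  by rewrite [u *m B *m _]mx11_scalar -/c scale_scalar_mx mulVf.
pose w := v *m B; have aw : adjmx w = B *m adjmx v by rewrite adjmxM hB.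
pose B' := B - adjmx w *m w.
have hB' : adjmx B' = B'.
  by rewrite /B' -scaleN1r adjmxD adjmxZ adjmxM adjmxK hB rmorphN1.
have vB' : v *m B' = 0.
  by rewrite /B' mulmxBr aw !mulmxA hv mul1mx subrr.
have sker : (col_mx v (kermx B) <= kermx B')%MS.
  apply/sub_kermxP; rewrite mul_col_mx vB' /B' mulmxBr mulmx_ker aw !mulmxA.
  by rewrite mulmx_ker !mul0mx subrr col_mx0.
have lt_ker : (\rank (kermx B) < \rank (kermx B'))%N.
  apply: rank_ltmx; apply/andP; split.
    by apply: submx_trans sker; rewrite -addsmxE addsmxSr.
  apply/negP=> le; have /sub_kermxP : (v <= kermx B)%MS.
    by apply: submx_trans le; apply: submx_trans sker; rewrite -addsmxE addsmxSl.
  by move=> vB; move: hv; rewrite vB mul0mx => /matrixP/(_ 0 0)/eqP; rewrite !mxE eq_sym oner_eq0.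
have rB' : (\rank B' <= r)%N.
  rewrite -ltnS; apply: leq_trans rB.
  by move: lt_ker; rewrite !mxrank_ker !ltnNge; apply: contra => /leq_sub2l.
have [M' EM'] := IH _ hB' rB'.
exists (col_mx w M' : 'M_(1 + r, n)).
by rewrite (adjmx_col w M') (mul_row_col (adjmx w)) -EM' /B' addrC subrK.
Qed.

(** Each row-free matrix is [1 0] times a unit: in its decomposition L [1 0] U the factor L passes
    to the right as diag(L, 1). *)
Lemma row_free_translate r n (M1 M2 : 'M[F]_(r, n)) :
  row_free M1 -> row_free M2 -> exists2 P : 'M_n, P \in unitmx & M2 = M1 *m P.
Proof.
move=> f1; have le_rn : (r <= n)%N by rewrite -(eqP f1) rank_leq_col.
move: M1 M2 f1; rewrite -(subnKC le_rn); move: (n - r)%N => m {le_rn n}.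
have std (M : 'M[F]_(r, r + m)) : row_free M ->
    exists2 P : 'M_(r + m), P \in unitmx & M = row_mx 1%:M 0 *m P.
  move=> /eqP fM; pose L := col_ebase M; pose U := row_ebase M.
  exists (block_mx L 0 0 1%:M *m U).
    rewrite unitmx_mul row_ebase_unit andbT unitmxE det_lblock det1 mulr1.
    by rewrite -unitmxE col_ebase_unit.
  rewrite mulmxA mul_row_block !mul1mx !mul0mx !addr0 -{1}(mulmx_ebase M) fM.
  by rewrite pid_mx_row mul_mx_row mulmx1 mulmx0.
move=> M1 M2 /std[P1 u1 ->] /std[P2 u2 ->].
by exists (invmx P1 *m P2); rewrite ?unitmx_mul ?unitmx_inv ?u1 // !mulmxA mulmxK.
Qed.

(** Gram factors with exactly [\rank B1] rows are row-free, hence differ by a unit on the right. *)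
Lemma herm_congruent n (B1 B2 : 'M_n) :
  (exists x, x + tau x != 0) ->
  (forall c, c != 0 -> tau c = c -> exists x, x * tau x = c) ->
  adjmx B1 = B1 -> adjmx B2 = B2 -> \rank B1 = \rank B2 ->
  exists2 P : 'M_n, P \in unitmx & B2 = adjmx P *m B1 *m P.
Proof.
move=> trN0 nsurj h1 h2 r12.
have [M1 E1] := herm_gram trN0 nsurj h1 (leqnn _).
have [M2 E2] := herm_gram trN0 nsurj h2 (leqnn _).
move: M2 E2; rewrite -r12 => M2 E2.
have free1 : row_free M1 by rewrite /row_free eqn_leq rank_leq_row {1}E1 mxrankM_maxr.
have free2 : row_free M2 by rewrite /row_free eqn_leq rank_leq_row {1}r12 {1}E2 mxrankM_maxr.
have [P uP EP] := row_free_translate free1 free2.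
by exists P; rewrite // {1}E2 EP adjmxM mulmxA -(mulmxA (adjmx P)) -E1.
Qed.

End ConjugateTranspose.

(** * Character sums and designs *)

Section Designs.

Variables (F : finFieldType) (q : nat) (tau : {rmorphism F -> F}).
Hypothesis q_gt1 : (1 < q)%N.
Hypothesis cardF : #|{: F}| = (q ^ 2)%N.
Hypothesis tauE : tau =1 conjq q.

Lemma ctmxE n (A : 'M[F]_n) : ctmx q A = adjmx tau A.
Proof. by apply/matrixP=> i j; rewrite !mxE tauE. Qed.

Lemma hermitianP n (A : 'M[F]_n) : reflect (adjmx tau A = A) (hermitian q A).
Proof. by rewrite /hermitian ctmxE; apply: eqP. Qed.

Lemma inFqE a : inFq q a = (tau a == a).
Proof. by rewrite tauE. Qed.

Lemma hermitian_congr n (P A : 'M[F]_n) :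
  hermitian q A -> hermitian q (adjmx tau P *m A *m P).
Proof.
move=> /hermitianP hA; apply/hermitianP.
by rewrite !adjmxM hA adjmxK ?mulmxA //; apply: tauK cardF tauE.
Qed.

Lemma trace_herm_fixed n (A B : 'M[F]_n) :
  hermitian q A -> hermitian q B -> inFq q (\tr (A *m B)).
Proof.
move=> /hermitianP hA /hermitianP hB.
by rewrite inFqE -trace_adjmx adjmxM hA hB mxtrace_mulC.
Qed.

Variable chi : F -> algC.

(** Substituting P A P^* for A permutes the Hermitian matrices of rank k, and cyclicity of the trace
    moves P across the pairing. *)
Lemma QkB_congr n k (P B : 'M[F]_n) : P \in unitmx ->
  QkB q chi k (adjmx tau P *m B *m P) = QkB q chi k B.
Proof.
move=> uP; have uaP : adjmx tau P \in unitmx by rewrite adjmx_unit.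
pose g (A : 'M[F]_n) := P *m A *m adjmx tau P.
pose h (A : 'M[F]_n) := invmx P *m A *m invmx (adjmx tau P).
have gK : cancel g h by move=> A; rewrite /g /h !mulmxA mulVmx // mul1mx mulmxK.
have hK : cancel h g by move=> A; rewrite /g /h !mulmxA mulmxV // mul1mx mulmxKV.
have tK : involutive tau := tauK cardF tauE.
rewrite /QkB [RHS](reindex_onto g h) => [|A _]; last exact: hK.
apply: eq_big => [A|A /andP[/hermitianP hA _]]; last first.
  rewrite /pairing !ctmxE hA /g !adjmxM hA adjmxK //; congr chi.
  by rewrite !mulmxA mxtrace_mulC !mulmxA.
rewrite gK eqxx andbT.
have <- : \rank A = \rank (g A).
  rewrite /g mxrankMfree ?row_free_unit // -[RHS]mxrank_tr trmx_mul mxrankMfree.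
    by rewrite mxrank_tr.
  by rewrite row_free_unit unitmx_tr.
have herm_g D (Q : 'M[F]_n) : hermitian q D -> hermitian q (Q *m D *m adjmx tau Q).
  by move=> hD; rewrite -{1}[Q](adjmxK tK); apply: hermitian_congr.
congr (_ && _); apply/idP/idP => [|hg]; first exact: herm_g.
by rewrite -[A]gK /h -adjmx_inv; apply: herm_g.
Qed.

(** [Qk] evaluates at a picked matrix of the given rank; Hermitian matrices of equal rank are
    congruent, so any choice gives the same sum. *)
Lemma Qk_rank n k (B : 'M[F]_n) :
  hermitian q B -> Qk q n chi k (\rank B) = QkB q chi k B.
Proof.
move=> hB; rewrite /Qk; case: pickP => [B' /andP[hB' /eqP rB']|/(_ B)]; last first.
  by rewrite hB eqxx.
have /hermitianP aB := hB; have /hermitianP aB' := hB'.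
have [P uP ->] := herm_congruent (tauK cardF tauE)
  (exists_trace_neq0 q_gt1 cardF tauE) (norm_surj q_gt1 cardF tauE) aB aB' (esym rB').
exact: QkB_congr.
Qed.

(** In an additive code every codeword arises as a difference in exactly [#|C|] ways, which cancels
    the normalisation. *)
Lemma dual_inner_distE n k (C : {set 'M[F]_n}) :
  additive_set C -> (forall A, A \in C -> hermitian q A) ->
  dual_inner_dist q chi C k = \sum_(Z in C) QkB q chi k Z.
Proof.
move=> [C0 CB] hC.
have CD A B : A \in C -> B \in C -> A + B \in C.
  by move=> AC BC; rewrite -[B]opprK CB // -[- B]add0r CB.
have cardC0 : #|C|%:R != 0 :> algC.
  by rewrite pnatr_eq0 -lt0n; apply/card_gt0P; exists 0.
transitivity (\sum_(XY : 'M[F]_n * 'M[F]_n | (XY.1 \in C) && (XY.2 \in C))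
    QkB q chi k (XY.1 - XY.2) / #|C|%:R).
  rewrite [RHS](partition_big (fun XY => inord (\rank (XY.1 - XY.2)) : 'I_n.+1) predT) //.
  apply: eq_bigr => i _; rewrite /inner_dist mulrA -sum1_card natr_sum mulr_sumr mulr_suml.
  apply: eq_big => [XY|XY /[!inE] /and3P[XC YC /eqP rXY]].
    rewrite inE -andbA; congr [&& _, _ & _].
    by rewrite -(inj_eq val_inj) /= inordK // ltnS rank_leq_row.
  by rewrite mulr1 -rXY Qk_rank // hC // CB.
rewrite -mulr_suml.
transitivity (\sum_(Y in C) (\sum_(Z in C) QkB q chi k Z) / #|C|%:R); last first.
  by rewrite sumr_const -[RHS](divfK cardC0) mulr_natr.
rewrite -mulr_suml; congr (_ / _).
rewrite -(pair_big (mem C) (mem C) (fun X Y => QkB q chi k (X - Y))) /= exchange_big.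
apply: eq_bigr => Y YC; rewrite (reindex_onto (+%R^~ Y) (fun X => X - Y)) => [|X _]; last exact: subrK.
apply: eq_big => [Z|Z _]; last by rewrite addrK.
rewrite addrK eqxx andbT; apply/idP/idP => [/CB/(_ YC)|/CD/(_ YC)] //.
by rewrite addrK.
Qed.

(** Orthogonality of characters: translating by a codeword [W] of value different from 1 multiplies
    the sum by that value, so the sum vanishes. *)
Lemma char_sum n (A : 'M[F]_n) (C : {set 'M[F]_n}) :
  nontriv_add_char q chi -> additive_set C ->
  (forall Z, Z \in C -> hermitian q Z) -> hermitian q A ->
  \sum_(Z in C) pairing q chi A Z =
    if [forall Z in C, pairing q chi A Z == 1] then #|C|%:R else 0.
Proof.
move=> [chi0 chiD _] [C0 CB] hC hA.
have CD B Z : B \in C -> Z \in C -> B + Z \in C.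
  by move=> BC ZC; rewrite -[Z]opprK CB // -[- Z]add0r CB.
case: ifPn => [/forall_inP all1|].
  rewrite -sumr_const; apply: eq_bigr => Z /all1/eqP; exact.
rewrite negb_forall => /existsP[W]; rewrite negb_imply => /andP[WC W1].
have /hermitianP aA := hA.
have fq Z : Z \in C -> inFq q (\tr (A *m Z)).
  by move=> ZC; apply: trace_herm_fixed => //; apply: hC.
set S := \sum_(Z in C) _.
have ES : S = pairing q chi A W * S.
  rewrite /S mulr_sumr (reindex_onto (+%R^~ W) (fun X => X - W)) => [|X _]; last exact: subrK.
  apply: eq_big => [Z|Z /andP[ZWC _]].
    rewrite addrK eqxx andbT; apply/idP/idP => [/CB/(_ WC)|/CD/(_ WC)] //.
    by rewrite addrK.
  have ZC : Z \in C by rewrite -[Z](addrK W) CB.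
  by rewrite /pairing ctmxE aA mulmxDr linearD chiD ?fq // mulrC.
apply/eqP; rewrite -[_ == 0]orFb -(negbTE W1) -subr_eq0 -mulf_eq0.
by rewrite mulrBl mul1r -ES subrr.
Qed.

(* A dual inner distribution entry counts, up to the factor #|C|, the rank-k
   Hermitian matrices that annihilate the code. *)
Lemma design_not_orthogonal n t k (C : {set 'M[F]_n}) (A : 'M[F]_n) :
  nontriv_add_char q chi -> additive_set C ->
  (forall Z, Z \in C -> hermitian q Z) -> is_design q chi t C ->
  (1 <= k <= t)%N -> hermitian q A -> \rank A = k ->
  exists2 Z, Z \in C & \tr (A *m Z) != 0.
Proof.
move=> chiN Cadd hC Cdes kt hA rA.
apply/exists_inP; case: (boolP [exists Z in C, _]) => // /exists_inPn orth.
have /eqP := Cdes k kt; rewrite dual_inner_distE // exchange_big /=.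
have [chi0 chiD _] := chiN; have [C0 _] := Cadd.
have Fq0 : inFq q (0 : F) by rewrite inFqE rmorph0.
have chi1 : chi 0 = 1.
  by apply: (mulfI (chi0 _ Fq0)); rewrite mulr1 -chiD // addr0.
have /hermitianP aA := hA.
(* Each rank-k matrix contributes [#|C|] or 0, so a zero total forces every contribution to be 0. *)
rewrite psumr_eq0 => [/allP/(_ A (mem_index_enum A))/implyP|B /andP[hB _]]; last first.
  by rewrite char_sum //; case: ifP.
rewrite hA rA eqxx => /(_ isT); rewrite char_sum // ifT.
  by rewrite pnatr_eq0 -leqn0 leqNgt => /negP[]; apply/card_gt0P; exists 0.
apply/forall_inP=> Z /orth; rewrite negbK /pairing ctmxE aA => /eqP->.
by rewrite chi1.
Qed.

End Designs.

(** * Multipliers X with X Z = Z X^* on the code *)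

Section SelfAdjointMultipliers.

Variables (F : finFieldType) (q : nat) (tau : {rmorphism F -> F}).
Hypothesis q_gt1 : (1 < q)%N.
Hypothesis cardF : #|{: F}| = (q ^ 2)%N.
Hypothesis tauE : tau =1 conjq q.

Variables (n d : nat) (chi : F -> algC) (C : {set 'M[F]_n}) (X : 'M[F]_n).
Hypothesis d_lt_n : (d < n)%N.
Hypothesis chiN : nontriv_add_char q chi.
Hypothesis maxC : max_add_herm_code q d C.
Hypothesis desC : is_design q chi (n - d) C.
Hypothesis XC : forall Z, Z \in C -> X *m Z = Z *m adjmx tau X.

Let tK : involutive tau := tauK cardF tauE.

(* The form of every Z in C takes a value in F_q at (v X, v), whereas a
   2-design realises every value of F_{q^2} at an independent pair. *)
Lemma multiplier_dependent_design (v : 'rV[F]_n) :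
  (2 <= n - d)%N -> ~~ row_free (col_mx v (v *m X)).
Proof.
move=> le2; apply/negP=> free_vX.
have [hC addC _ _] := maxC.
(* Multiplying by this [a] turns the skew-Hermitian difference in [EA] into a Hermitian matrix. *)
have [a a0 ta] := exists_antifixed q_gt1 cardF tauE.
pose W := col_mx v (v *m X).
pose D : 'M[F]_(1 + 1) := block_mx 0 (- a)%:M a%:M 0.
pose A := adjmx tau W *m D *m W.
have EA : A = a *: (adjmx tau (v *m X) *m v) - a *: (adjmx tau v *m (v *m X)).
  rewrite /A /W adjmx_col mul_row_block !mulmx0 addr0 add0r mul_row_col.
  by rewrite !mul_mx_scalar scaleNr mulNmx -!scalemxAl.
have hA : hermitian q A.
  apply/(hermitianP tauE); rewrite EA -scaleNr adjmxD !adjmxZ !adjmxM !adjmxK //.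
  by rewrite rmorphN /= ta opprK scaleNr addrC -adjmxM.
have rA : \rank A = 2.
  rewrite /A mxrankMfree // -mxrank_tr trmx_mul mxrankMfree ?mxrank_tr.
    apply/eqP; rewrite -[_ == _]/(row_free _) row_free_unit.
    have /mulmx1_unit[] // : D *m block_mx 0 a^-1%:M (- a^-1)%:M 0 = 1%:M.
    rewrite mulmx_block !mul0mx !mulmx0 !addr0 !add0r -!scalar_mxM.
    by rewrite mulrNN !mulfV // -scalar_mx_block.
  by rewrite trmxK /row_free mxrank_map.
have k2 : (1 <= 2 <= n - d)%N by [].
have [Z ZC] := design_not_orthogonal q_gt1 cardF tauE chiN addC hC desC k2 hA rA.
(* By cyclicity the trace is [a] times the difference of v Z X^* v^* and v X Z v^*, which the
   multiplier identity makes 0. *)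
case/negP; rewrite EA mulmxBl linearB /= -!scalemxAl !linearZ /= -mulrBr.
rewrite -!mulmxA !(mxtrace_mulC (adjmx tau _)) adjmxM.
by rewrite -!mulmxA (mulmxA X) (XC ZC) -!mulmxA subrr mulr0.
Qed.

(** For n = d + 1 the code has q^(2n) elements, as many as the row space, so the injective map Z to
    v Z would be onto. But with u = v X, every w = v Z has w u^* in F_q, and some vector w fails
    this. *)
Lemma multiplier_dependent_card (v : 'rV[F]_n) :
  n = d.+1 -> ~~ row_free (col_mx v (v *m X)).
Proof.
move=> En; apply/negP=> free_vX.
have [hC [C0 CB] rkC cardC] := maxC.
have hCP Z : Z \in C -> adjmx tau Z = Z by move=> /hC/(hermitianP tauE).
pose u := v *m X.
have injC : {in C &, injective (fun Z => v *m Z)}.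
  move=> Z1 Z2 Z1C Z2C /= E; apply/eqP; apply: contraT => neq.
  have ZC := CB _ _ Z1C Z2C; have vZ : v *m (Z1 - Z2) = 0 by rewrite mulmxBr E subrr.
  have : col_mx v u *m (Z1 - Z2) = 0.
    by rewrite mul_col_mx vZ /u -mulmxA XC // mulmxA vZ mul0mx col_mx0.
  (* A nonzero codeword killed on the left by both [v] and [u] would have rank at most n - 2 = d -
     1. *)
  move/mulmx0_rank_max; rewrite (eqP free_vX).
  by rewrite leqNgt {1}En addnC !addnS addn0 ltnS ltnS rkC.
have u0 : u != 0.
  apply: contraL free_vX => /eqP; rewrite -/u => ->.
  rewrite /row_free -addsmxE addsmx0.
  by rewrite neq_ltn ltnS rank_leq_row.
have [y ny] := exists_not_fixed q_gt1 cardF tauE.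
have [w nw] : exists w : 'rV[F]_n, tau ((w *m adjmx tau u) 0 0) != (w *m adjmx tau u) 0 0.
  have [i ui] : exists i, u 0 i != 0.
    apply/existsP; apply: contraNT u0 => /existsPn uz.
    by apply/eqP/rowP=> i; rewrite [RHS]mxE; apply/eqP; rewrite -[_ == _]negbK uz.
  (* One nonzero coordinate of [u] suffices: the scaling makes w u^* equal to the non-fixed [y]. *)
  exists ((y / tau (u 0 i)) *: delta_mx 0 i).
  by rewrite -scalemxAl -rowE /adjmx !mxE divfK // fmorph_eq0; move: ui; rewrite !mxE.
pose S := [set w : 'rV[F]_n | tau ((w *m adjmx tau u) 0 0) == (w *m adjmx tau u) 0 0].
have subS : [set v *m Z | Z in C] \subset S.
  apply/subsetP=> _ /imsetP[Z ZC ->]; rewrite inE; apply/eqP.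
  rewrite -form_adjmx ?hCP // /u adjmxM !mulmxA -(mulmxA v X) (XC ZC).
  by rewrite !mulmxA.
have : (#|S| < #|{: 'rV[F]_n}|)%N.
  by apply/proper_card/properP; split; [apply/subsetP | exists w; rewrite ?inE].
apply/negP; rewrite -leqNgt card_mx cardF mul1n.
move/subset_leq_card: subS; rewrite card_in_imset // cardC; apply: leq_trans.
by rewrite En subSnn -expnM mulnC.
Qed.

(** Every nonzero vector is an eigenvector of X, so X is scalar; the multiplier identity on a
    nonzero codeword then puts the scalar in F_q. *)
Lemma multiplier_scalar : exists2 a, tau a = a & X = a%:M.
Proof.
have n_gt0 : (0 < n)%N by apply: leq_ltn_trans d_lt_n.
have eigen (v : 'rV[F]_n) : v != 0 -> exists a, v *m X = a *: v.
  move=> v0; apply/sub_rVP; apply: contraT => nsub.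
  have free_vX : row_free (col_mx v (v *m X)).
    apply: inj_row_free => w; rewrite -[w]hsubmxK mul_row_col.
    rewrite [lsubmx w]mx11_scalar [rsubmx w]mx11_scalar !mul_scalar_mx.
    set b := lsubmx w 0 0; set c := rsubmx w 0 0 => /eqP; have [->|c0] := eqVneq c 0.
      rewrite scale0r addr0 scaler_eq0 (negbTE v0) orbF => /eqP->.
      by rewrite -row_mx0; congr row_mx; apply/rowP=> k; rewrite !mxE mul0rn.
    rewrite addrC addr_eq0 => /eqP E; case/sub_rVP: nsub; exists (- (c^-1 * b)).
    by rewrite -[LHS](scalerK c0) E scalerN scalerA scaleNr.
  (* Either n - d = 1, settled by counting, or n - d >= 2, settled by the design property. *)
  move: (d_lt_n); rewrite -subn_gt0 leq_eqVlt => /orP[/eqP E|le2].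
    have En : n = d.+1 by rewrite -(subnK (ltnW d_lt_n)) -E.
    by have := multiplier_dependent_card v En; rewrite free_vX.
  by have := multiplier_dependent_design v le2; rewrite free_vX.
have [a Xa] : exists a, X = a%:M.
  have rowXE i j a : row i X = a *: delta_mx 0 i -> X i j = a * (j == i)%:R.
    by move/rowP/(_ j); rewrite !mxE.
  have delta0 i : delta_mx 0 i != 0 :> 'rV[F]_n.
    by apply: contraTneq isT => /rowP/(_ i)/eqP; rewrite !mxE !eqxx oner_eq0.
  have offdiag i j : i != j -> X i j = 0.
    have [a] := eigen _ (delta0 i); rewrite -rowE => /rowXE-> ij.
    by rewrite eq_sym (negbTE ij) mulr0.
  have diag i j : X i i = X j j.
    have [-> //|ij] := eqVneq i j.
    have sum0 : delta_mx 0 i + delta_mx 0 j != 0 :> 'rV[F]_n.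
      apply: contraTneq isT => /rowP/(_ i)/eqP.
      by rewrite !mxE !eqxx (negbTE ij) addr0 oner_eq0.
    have [a] := eigen _ sum0; rewrite mulmxDl -!rowE => /rowP E.
    have := E i; have := E j; rewrite !mxE !eqxx (negbTE ij) (eq_sym j) (negbTE ij).
    by rewrite (offdiag i j) // (offdiag j i) 1?eq_sym // !addr0 !add0r => -> ->.
  exists (X (Ordinal n_gt0) (Ordinal n_gt0)); apply/matrixP=> i j; rewrite mxE.
  by have [->|/offdiag->//] := eqVneq i j; rewrite (diag j (Ordinal n_gt0)).
exists a => //.
have [hC [C0 _] _ cardC] := maxC.
have [Z ZC Z0] : exists2 Z, Z \in C & Z != 0.
  apply/exists_inP; apply: contraT => /exists_inPn all0.
  have : (#|C| <= 1)%N.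
    rewrite -(cards1 (0 : 'M[F]_n)); apply/subset_leq_card/subsetP=> Z /all0.
    by rewrite negbK inE.
  by rewrite cardC leqNgt -{1}(expn0 q) ltn_exp2l // muln_gt0 n_gt0 addn1.
have := XC ZC; rewrite Xa mul_scalar_mx /adjmx map_scalar_mx tr_scalar_mx mul_mx_scalar.
by move/eqP; rewrite -subr_eq0 -scalerBl scaler_eq0 (negbTE Z0) orbF subr_eq0 => /eqP/esym.
Qed.

End SelfAdjointMultipliers.

(** * From extended equivalence to equivalence *)

(* With S = sigma(Z), hermiticity of A S B and of S gives Y S = S Y^* for
   Y = (B^* )^-1 A; pulling Y back along sigma gives a multiplier of C1. *)
Lemma ext_multiplier (F : finFieldType) (q : nat) (tau sigma : {rmorphism F -> F})
    (n : nat) (C1 : {set 'M[F]_n}) (A B : 'M[F]_n) :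
  involutive tau -> tau =1 conjq q -> bijective sigma -> B \in unitmx ->
  (forall Z, Z \in C1 -> hermitian q Z) ->
  (forall Z, Z \in C1 -> hermitian q (A *m map_mx sigma Z *m B)) ->
  exists2 X, A = adjmx tau B *m map_mx sigma X
    & forall Z, Z \in C1 -> X *m Z = Z *m adjmx tau X.
Proof.
move=> tK tE [g sK gK] uB hC hACB.
(* [tau] is a power map, so it commutes with [sigma]. *)
have st x : sigma (tau x) = tau (sigma x) by rewrite !tE /conjq rmorphXn.
have uaB : adjmx tau B \in unitmx by rewrite adjmx_unit.
pose Y := invmx (adjmx tau B) *m A; pose X := map_mx g Y.
have EY : map_mx sigma X = Y by apply/matrixP=> i j; rewrite mxE [X i j]mxE gK.
exists X => [|Z ZC]; first by rewrite EY /Y mulmxA mulmxV // mul1mx.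
apply: (map_mx_inj (f := sigma)).
rewrite !map_mxM /= -adjmx_map // EY.
have /(hermitianP tE) hZ := hC Z ZC.
have hS : adjmx tau (map_mx sigma Z) = map_mx sigma Z by rewrite adjmx_map // hZ.
have /(hermitianP tE) := hACB Z ZC.
rewrite /Y !adjmxM hS adjmx_inv adjmxK // => E.
(* Multiplying by B^* on the left and by B on the right turns the claim into the hermiticity of A S
   B. *)
apply: (can_inj (mulKmx uaB)); apply: (can_inj (mulmxK uB)).
by rewrite !mulmxA mulmxKV // mulmxV // mul1mx -E !mulmxA.
Qed.

Theorem theorem3p5 (F : finFieldType) (q n d : nat) (chi : F -> algC)
    (C1 C2 : {set 'M[F]_n}) :
  (exists p k : nat, [/\ prime p, (0 < k)%N & q = (p ^ k)%N]) ->
  #|{: F}| = (q ^ 2)%N ->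
  (d < n)%N ->
  nontriv_add_char q chi ->
  max_add_herm_code q d C1 -> max_add_herm_code q d C2 ->
  is_design q chi (n - d) C1 -> is_design q chi (n - d) C2 ->
  (equiv_herm q C1 C2 <-> ext_equiv C1 C2).
Proof.
move=> [p [k [pr_p k_gt0 Eq]]] cardF ltdn chiN max1 max2 des1 _.
have q_gt1 : (1 < q)%N by rewrite Eq -(expn0 p) ltn_exp2l // prime_gt1.
have [tau tE] := conjq_rmorphism pr_p Eq cardF; have tK := tauK cardF tE.
split=> [[a [rho [A [B [/andP[_ a0] brho uA _ ->]]]]]|].
  exists (a *: A), (ctmx q A), rho, B.
  rewrite unitmxZ ?unitfE // (ctmxE tE) adjmx_unit; split=> //; left.
  by apply: eq_imset => Z; rewrite !scalemxAl.
have [hC1 [C10 _] _ _] := max1; have [hC2 [_ C2B] _ _] := max2.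
have main (A B R : 'M[F]_n) (sigma : {rmorphism F -> F}) :
    A \in unitmx -> B \in unitmx -> bijective sigma ->
    C2 = [set A *m map_mx sigma C *m B + R | C in C1] -> equiv_herm q C1 C2.
  move=> uA uB bsigma EC2.
  have inC2 Z : Z \in C1 -> A *m map_mx sigma Z *m B + R \in C2.
    by move=> ZC; rewrite EC2; apply/imsetP; exists Z.
  (* [R] is the image of 0, hence a codeword, and subtracting it stays inside the Hermitian code. *)
  have RC2 : R \in C2 by have := inC2 _ C10; rewrite map_mx0 mulmx0 mul0mx add0r.
  have hACB Z : Z \in C1 -> Defs.hermitian q (A *m map_mx sigma Z *m B).
    by move=> ZC; rewrite hC2 // -[_ *m B](addrK R) C2B ?inC2.
  have [X EA XC] := ext_multiplier tK tE bsigma uB hC1 hACB.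
  have [a ta EX] := multiplier_scalar q_gt1 cardF tE ltdn chiN max1 des1 XC.
  (* A and B^* are proportional, so B^* can serve as the congruence matrix, with sigma(a) as the F_q
     factor. *)
  have {EX} EA : A = sigma a *: adjmx tau B.
    by rewrite EA EX map_scalar_mx mul_mx_scalar.
  have sa0 : sigma a != 0.
    apply: contraTneq uA => sa0; rewrite EA sa0 scale0r.
    by rewrite -row_free_unit /row_free mxrank0 eq_sym -lt0n (leq_ltn_trans _ ltdn).
  exists (sigma a), sigma, (adjmx tau B), R; split=> //.
  - by rewrite sa0 andbT (inFqE tE) tE /conjq -rmorphXn -/(conjq q a) -tE ta.
  - by rewrite adjmx_unit.
  - exact: hC2.
  - by rewrite EC2; apply: eq_imset => Z; rewrite (ctmxE tE) adjmxK // EA -!scalemxAl.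
move=> [A [B [sigma [R [uA uB bsigma [EC2|EC2]]]]]]; first exact: (main A B R sigma).
have btau : bijective tau by exists tau.
apply: (main A B R (sigma \o tau)) => //; first exact: bij_comp.
rewrite EC2; apply: eq_in_imset => Z /hC1/(hermitianP tE) hZ.
by rewrite -{1}hZ /adjmx -map_trmx trmxK -map_mx_comp.
Qed.
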